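(* Let $S:[0,1)\to[0,1)$ be an interval translation map with branches $I_1,\dots,I_n$ and let $\mu$ be a non-atomic $S$-invariant Borel probability measure with support $J$. Assume that $\mu$ is branchwise nonsingular on the support. Then, for every branch $I_k$, $$\operatorname{supp}\rho_k=\overline{\mathcal C_{\mathrm{gap},k}}.$$
   Context: Interval translation map: there are $0=t_0<\dots<t_n=1$ and $c_k\in\mathbb R$ such that, with $I_k=[t_{k-1},t_k)$ (the branches), $S(x)=\tau_k(x):=x+c_k\in[0,1)$ for all $x\in I_k$. $S$-invariance means $\mu(S^{-1}B)=\mu(B)$ for all Borel $B$. The measure $\mu$ is also regarded as a measure on $[0,1]$ with $\mu(\{1\})=0$; $J=\operatorname{supp}\mu$ is closed in $[0,1]$; $h(x)=\mu([0,x])$, $x\in[0,1]$. Branchwise nonsingular on the support: for every branch $I_k$ and every Borel set $N\subset J\cap I_k$ with $\mu(N)=0$ one has $\mu(\tau_k(N))=0$. Defect measures: for Borel $B\subset I_k$, $\sigma_k(B)=\mu(\tau_k(B))-\mu(B)$, which is a finite positive Borel measure on $I_k$; for Borel $E\subset[0,1]$, $\rho_k(E)=\sigma_k(h^{-1}(E)\cap I_k)$. A branchwise gap in $I_k$ is a connected component $G=(a,b)$ of $(t_{k-1},t_k)\setminus J$; it is active if $\mu(\tau_k(G))>0$. Since $h(a)=h(b)$, write $h(G)$ for this common value. $\mathcal C_{\mathrm{gap},k}=\{h(G): G\text{ an active branchwise gap in }I_k\}\subset[0,1]$, and the bar denotes closure in $[0,1]$. *)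

(* Defs.v *)
From HB Require Import structures.
From mathcomp Require Import all_boot all_order all_algebra.
From mathcomp Require Import all_classical all_reals all_analysis.

Set Implicit Arguments.
Unset Strict Implicit.
Unset Printing Implicit Defensive.

Import Order.TTheory GRing.Theory Num.Theory.
Import numFieldNormedType.Exports.

Local Open Scope classical_set_scope.
Local Open Scope ring_scope.

(* Maps and measures on [0,1) are represented on the whole real line: only the
   restriction of S to [0,1) is constrained, and a Borel probability on [0,1)
   is a Borel probability on R giving mass 1 to [0,1).  Branches are numbered
   from 0, so [branch t k] is [t_k, t_(k+1)) for k < n; the values of t beyond
   n play no role. *)

Section interval_translation_maps.
Context {R : realType}.

Definition branch n (t : nat -> R) (k : 'I_n) : set R :=
  [set` `[t k, t k.+1[].

Definition tau n (c : 'I_n -> R) (k : 'I_n) (x : R) : R := x + c k.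

Definition is_itm n (t : nat -> R) (c : 'I_n -> R) (S : R -> R) : Prop :=
  [/\ t 0%N = 0, t n = 1,
      (forall k : 'I_n, t k < t k.+1) &
      (forall (k : 'I_n) (x : R), branch t k x ->
         S x = tau c k x /\ tau c k x \in `[0, 1[)].

Definition itm_invariant (S : R -> R) (mu : set R -> \bar R) : Prop :=
  forall B : set (measurableTypeR R),
    measurable B -> B `<=` [set` `[0, 1[] ->
    mu ([set` `[0, 1[] `&` S @^-1` B) = mu B.

Definition non_atomic (mu : set R -> \bar R) : Prop :=
  forall x : R, mu [set x] = 0%E.

(* For a measure carried by [0,1], this is also its support as a measure on
   the space [0,1], because [0,1] is closed in R. *)
Definition supp (mu : set R -> \bar R) : set R :=
  [set x | forall U : set R, open U -> U x -> (0 < mu U)%E].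

Definition distr_fun (mu : set R -> \bar R) (x : R) : R :=
  fine (mu [set` `[0, x]]).

Definition nonsingular_on_supp n (t : nat -> R) (c : 'I_n -> R)
    (mu : set R -> \bar R) : Prop :=
  forall (k : 'I_n) (N : set (measurableTypeR R)),
    measurable N -> N `<=` supp mu `&` branch t k ->
    mu N = 0%E -> mu (tau c k @` N) = 0%E.

Definition defect n (c : 'I_n -> R) (mu : set R -> \bar R) (k : 'I_n)
    (B : set R) : \bar R :=
  (mu (tau c k @` B) - mu B)%E.

Definition rho n (t : nat -> R) (c : 'I_n -> R) (mu : set R -> \bar R)
    (k : 'I_n) (E : set R) : \bar R :=
  defect c mu k (distr_fun mu @^-1` E `&` branch t k).

Definition is_branch_gap n (t : nat -> R) (mu : set R -> \bar R) (k : 'I_n)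
    (a b : R) : Prop :=
  let D := [set` `]t k, t k.+1[] `\` supp mu in
  exists2 x, D x & connected_component D x = [set` `]a, b[].

Definition is_active n (c : 'I_n -> R) (mu : set R -> \bar R) (k : 'I_n)
    (G : set R) : Prop :=
  (0 < mu (tau c k @` G))%E.

(* The common value of the distribution function at the two ends of a gap is
   read off at the left end. *)
Definition gap_values n (t : nat -> R) (c : 'I_n -> R) (mu : set R -> \bar R)
    (k : 'I_n) : set R :=
  [set y | exists a b : R,
     [/\ is_branch_gap t mu k a b,
         is_active c mu k [set` `]a, b[] &
         y = distr_fun mu a]].

End interval_translation_maps.

(* Main.v *)
(* The defect measure vanishes on the support.  Otherwise, since it is
   absolutely continuous with respect to mu there, some A of positive measure in
   the branch is expanded: mu (tau B) >= a mu B for all B in A, with a > 1.  A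
   set of measure bounded below visits A about m mu(A) / 2 times before time m,
   so S^m expands it by an exponentially large factor.  But S^m x is determined
   by x and the numbers of visits of x to the n branches, so [0,1) splits into at
   most (m+1)^n sets on which S^m is a translation, hence injective, and the
   image of each of them has measure at most 1: a contradiction.

   So the defect is carried by the gaps, where mu vanishes and h is constant:
   rho_k is a sum of point masses mu (tau G) at the points h(G), and its support
   is the closure of the values of the active gaps. *)
Require Import Defs.
From HB Require Import structures.
From mathcomp Require Import all_boot all_order all_algebra.
From mathcomp Require Import all_classical all_reals all_analysis.
From mathcomp Require Import measurable_realfun ring lra zify.
Import Order.TTheory GRing.Theory Num.Theory.
Import numFieldNormedType.Exports.
Local Open Scope classical_set_scope.
Local Open Scope ring_scope.

(** * Expanded sets of maps with polynomially many injectivity domains *)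

Lemma bernoulli_ineq (R : realDomainType) (e : R) (i : nat) :
  0 <= e -> 1 + i%:R * e <= (1 + e) ^+ i.
Proof.
move=> e0; elim: i => [|i IHi]; first by rewrite expr0 mul0r addr0.
rewrite exprS -natr1; have := ler_wpM2l (addr_ge0 ler01 e0) IHi.
apply: le_trans.
have : 0 <= i%:R * e * e by rewrite !mulr_ge0.
lra.
Qed.

(** With [a = 1 + e] and [j = i * p.+1], Bernoulli gives [a ^+ j >= (i * e) ^+ p.+1], of degree
    [p.+1] in [i], while the left-hand side grows only like [i ^+ p]. *)
Lemma exp_gt_poly (R : realType) (a C : R) (p q : nat) : 1 < a -> 0 <= C ->
  exists2 j, (0 < j)%N & C * ((q * j).+1%:R) ^+ p < a ^+ j.
Proof.
move=> a1 C0; pose e := a - 1; have e0 : 0 < e by rewrite subr_gt0.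
pose K : R := ((q * p.+1).+1%:R) ^+ p.
have K0 : 0 < K by rewrite exprn_gt0.
(* Chosen so that [C * K * i ^+ p = D * (i ^+ p * e ^+ p.+1)]; the comparison then reduces to
   [D < i]. *)
pose D := C * K / e ^+ p.+1.
have D0 : 0 <= D by rewrite /D !mulr_ge0// ?invr_ge0 ?exprn_ge0// ltW.
have Di := archi_boundP D0.
set i := (Num.bound D) in Di.
have i0 : 0 < i%:R :> R by rewrite (le_lt_trans D0).
have i0' : (0 < i)%N by rewrite -(ltr0n R).
exists (i * p.+1)%N; first by rewrite muln_gt0 i0'.
have h1 : i%:R * e <= a ^+ i.
  have := @bernoulli_ineq _ e i (ltW e0).
  by rewrite (_ : 1 + e = a); [lra|rewrite /e; ring].
rewrite exprM (@lt_le_trans _ _ ((i%:R * e) ^+ p.+1))//; last first.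
  by rewrite lerXn2r// nnegrE ?exprn_ge0 ?mulr_ge0// ltW// (lt_trans ltr01).
rewrite (@le_lt_trans _ _ (C * K * i%:R ^+ p))//.
  rewrite -mulrA ler_wpM2l// -exprMn lerXn2r// ?nnegrE// -natrM ler_nat; nia.
have -> : C * K * i%:R ^+ p = D * (i%:R ^+ p * e ^+ p.+1).
  by rewrite mulrCA /D mulfVK ?lt0r_neq0 ?exprn_gt0// mulrC.
have -> : (i%:R * e) ^+ p.+1 = i%:R * (i%:R ^+ p * e ^+ p.+1).
  by rewrite exprMn (exprS i%:R) mulrA.
by rewrite ltr_pM2r// mulr_gt0// exprn_gt0.
Qed.

Section expanding.
Context {d : measure_display} {X : measurableType d} {R : realType}.
Implicit Types (A B : set X) (T : X -> X) (mu : probability X R).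

Definition visits T A (m : nat) (x : X) : nat :=
  \sum_(i < m) (iter i T x \in A).

Lemma visitsS T A m x :
  visits T A m.+1 x = ((x \in A) + visits T A m (T x))%N.
Proof.
rewrite /visits big_ord_recl/=; congr addn.
by apply: eq_bigr => i _; rewrite /bump/= -iterS iterSr.
Qed.

Lemma visits_le T A m x : (visits T A m x <= m)%N.
Proof.
rewrite (@leq_trans (\sum_(i < m) 1))//; last by rewrite sum1_card card_ord.
by apply: leq_sum => i _; exact: leq_b1.
Qed.

Lemma measurable_image_iter T :
    (forall B, measurable B -> measurable (T @` B)) ->
  forall m B, measurable B -> measurable (iter m T @` B).
Proof.
move=> img; elim=> [|m IHm] B mB; first by rewrite /= image_id.
have -> : iter m.+1 T @` B = T @` (iter m T @` B) by rewrite image_comp.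
exact/img/IHm.
Qed.

Lemma measurable_iter T : measurable_fun setT T ->
  forall m, measurable_fun setT (iter m T).
Proof.
move=> mT; elim=> [|m IHm]; first exact: measurable_id.
by rewrite (_ : iter m.+1 T = T \o iter m T)//; exact: measurableT_comp.
Qed.

Lemma visitsE T A m x :
  (visits T A m x)%:R = \sum_(i < m) \1_A (iter i T x) :> R.
Proof. by rewrite /visits natr_sum; apply: eq_bigr => i _; rewrite indicE. Qed.

Lemma measurable_visits T A m : measurable_fun setT T -> measurable A ->
  measurable_fun setT (fun x => (visits T A m x)%:R : R).
Proof.
move=> mT mA; rewrite (_ : (fun x => _) = 
    (fun x => \sum_(i < m) \1_A (iter i T x))); last first.
  by apply/funext => x; rewrite visitsE.
apply: measurable_sum => i.
exact: (measurableT_comp (measurable_indic mA) (measurable_iter _ mT i)).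
Qed.

Lemma measurable_visits_ge T A m j : measurable_fun setT T -> measurable A ->
  measurable [set x | (j <= visits T A m x)%N].
Proof.
move=> mT mA; have := @measurable_visits T A m mT mA measurableT
  [set` `[(j%:R : R), +oo[] (measurable_itv _).
rewrite setTI; congr measurable; apply/seteqP; split=> x /=;
  by rewrite in_itv/= andbT ler_nat.
Qed.

Lemma invariant_iter mu T : measurable_fun setT T ->
    (forall B, measurable B -> mu (T @^-1` B) = mu B) ->
  forall m B, measurable B -> mu (iter m T @^-1` B) = mu B.
Proof.
move=> mT inv; elim=> [//|m IHm] B mB.
rewrite -[RHS]inv// -[RHS]IHm//.
by rewrite -[X in measurable X]setTI; exact: mT.
Qed.

(* The integral of the number of visits is [m * mu A], by invariance. *)
Lemma visits_chebyshev mu T A m j : measurable_fun setT T -> measurable A ->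
    (forall B, measurable B -> mu (T @^-1` B) = mu B) ->
  (m%:R%:E * mu A <=
   m%:R%:E * mu [set x | (j <= visits T A m x)%N] + j%:R%:E)%E.
Proof.
move=> mT mA inv; set E := [set x | _].
have mE : measurable E by exact: measurable_visits_ge.
have mV : measurable_fun setT (fun x => (visits T A m x)%:R%:E : \bar R).
  by apply/measurable_EFinP; exact: measurable_visits.
have <- : (\int[mu]_x (visits T A m x)%:R%:E = m%:R%:E * mu A)%E.
  transitivity (\int[mu]_x (\sum_(i < m) (\1_A (iter i T x))%:E)%E)%E.
    by apply: eq_integral => x _; rewrite visitsE sumEFin.
  rewrite ge0_integral_sum//; last first.
  - move=> i; apply/measurable_EFinP.
    exact: (measurableT_comp (measurable_indic mA) (measurable_iter _ mT i)).
  - rewrite (eq_bigr (fun=> mu A)); last first.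
      move=> i _; rewrite -[RHS](invariant_iter mu T mT inv i A mA).
      rewrite -[X in mu X]setIT -integral_indic//.
      by rewrite -[X in measurable X]setTI; exact: measurable_iter.
    by rewrite sumr_const card_ord mule_natl.
(* The right-hand side is the integral of [m * \1_E + j], which dominates the number of visits:
   there are at most [m] on [E] and fewer than [j] off [E]. *)
have -> : (m%:R%:E * mu E + j%:R%:E =
    \int[mu]_x (m%:R%:E * (\1_E x)%:E + j%:R%:E))%E.
  rewrite ge0_integralD//.
  - rewrite ge0_integralZl//; last by apply/measurable_EFinP.
    rewrite integral_indic// setIT integral_cst//.
    by rewrite -[in LHS](mule1 j%:R%:E) -(probability_setT mu).
  - by apply/measurable_EFinP; apply: measurable_funM.
apply: ge0_le_integral => //.
  by apply/measurable_EFinP; apply: measurable_funD => //; apply: measurable_funM.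
move=> x _; rewrite -EFinM -EFinD lee_fin indicE.
case: (boolP (x \in E)) => [_|/negP xE].
  by rewrite mulr1 -natrD ler_nat (leq_trans _ (leq_addr _ _))// visits_le.
rewrite mulr0 add0r ler_nat leqNgt; apply/negP => /ltnW jx.
by apply: xE; rewrite inE.
Qed.

(** Induction on [m], splitting [B] by whether the starting point lies in [A]. The part inside [A]
    gains a factor [a] and has one visit fewer left to make; the other part does not shrink.
    Injectivity keeps the two images disjoint, so their measures add up. *)
Lemma expansion_iter mu T A (a : R) :
    (forall B, measurable B -> measurable (T @` B)) ->
    (forall B, measurable B -> (mu B <= mu (T @` B))%E) ->
    measurable A -> 1 <= a ->
    (forall B, measurable B -> B `<=` A -> (a%:E * mu B <= mu (T @` B))%E) ->
  forall m j B, measurable B -> set_inj B (iter m T) ->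
    (forall x, B x -> (j <= visits T A m x)%N) ->
  ((a ^+ j)%:E * mu B <= mu (iter m T @` B))%E.
Proof.
move=> img inc mA a1 exp; elim=> [|m IHm] j B mB injB jB.
  case: j jB => [|j] jB; first by rewrite expr0 mul1e /= image_id.
  suff -> : B = set0 by rewrite image_set0 measure0 mule0.
  by apply/seteqP; split => // x /jB; rewrite /visits big_ord0.
have imgm := measurable_image_iter T img.
have iS C : iter m.+1 T @` C = iter m T @` (T @` C).
  by rewrite image_comp; apply: eq_imagel => x _ /=; rewrite -iterS iterSr.
have sub C : C `<=` B -> set_inj (T @` C) (iter m T).
  move=> CB _ _ /set_mem[x Cx <-] /set_mem[y Cy <-]; rewrite -!iterSr => xy.
  congr T; apply: injB => //; exact/mem_set/CB.
pose B1 := B `&` A; pose B2 := B `\` A.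
have mB1 : measurable B1 by exact: measurableI.
have mB2 : measurable B2 by exact: measurableD.
have B12 : B = B1 `|` B2 by rewrite setUIDK.
have a0 : 0 < a by rewrite (lt_le_trans ltr01).
have h1 : ((a ^+ j)%:E * mu B1 <= mu (iter m.+1 T @` B1))%E.
  have e1 : (a%:E * mu B1 <= mu (T @` B1))%E by apply: exp => // x [].
  case: j jB => [|j] jB.
    rewrite expr0 mul1e iS (le_trans (inc _ mB1))//.
    rewrite -[leLHS]mul1e -(expr0 a); apply: IHm => //; first exact: img.
    by apply: sub => x [].
  rewrite iS; apply: le_trans (IHm j _ (img _ mB1) _ _).
  - rewrite exprSr EFinM -muleA lee_pmul2l//= lte_fin exprn_gt0//.
  - by apply: sub => x [].
  - move=> _ [x [Bx Ax] <-]; have := jB _ Bx.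
    by rewrite visitsS mem_set.
have h2 : ((a ^+ j)%:E * mu B2 <= mu (iter m.+1 T @` B2))%E.
  rewrite iS; apply: le_trans (IHm j _ (img _ mB2) _ _).
  - by rewrite lee_pmul2l//= ?lte_fin ?exprn_gt0// inc.
  - by apply: sub => x [].
  - move=> _ [x [Bx Ax] <-]; have := jB _ Bx.
    by rewrite visitsS memNset.
have d12 : B1 `&` B2 = set0.
  by apply/seteqP; split => // x [[_ ?] []].
rewrite [in leRHS]B12 image_setU measureU; [|exact: imgm|exact: imgm|].
- rewrite [in leLHS]B12 measureU// ge0_muleDr ?measure_ge0//.
  exact: leeD.
- apply/seteqP; split => // _ [[x B1x <-]] [y B2y] /eqP yx.
  have exy : x = y.
    apply: injB; [by apply/mem_set; case: B1x|by apply/mem_set; case: B2y|].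
    by move/eqP: yx.
  have : (B1 `&` B2) x by split; rewrite // exy.
  by rewrite d12.
Qed.

(** If [A] had positive measure, the set of frequent visitors would be expanded exponentially, while
    the polynomially many pieces [Y i] have images of measure at most 1. *)
Lemma expanding_null mu T A (a : R) (p : nat) :
    measurable_fun setT T ->
    (forall B, measurable B -> mu (T @^-1` B) = mu B) ->
    (forall B, measurable B -> measurable (T @` B)) ->
    (forall m, exists (I : finType) (Y : I -> set X),
      [/\ (#|I| <= m.+1 ^ p)%N, forall i, measurable (Y i),
          forall x, exists i, Y i x & forall i, set_inj (Y i) (iter m T)]) ->
    measurable A -> 1 < a ->
    (forall B, measurable B -> B `<=` A -> (a%:E * mu B <= mu (T @` B))%E) ->
  mu A = 0%E.
Proof.
move=> mT inv img cov mA a1 exp.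
have inc B : measurable B -> (mu B <= mu (T @` B))%E.
  move=> mB; rewrite -(inv (T @` B)); last exact: img.
  apply: le_measure; rewrite ?inE//; last exact: preimage_image.
  by rewrite -[X in measurable X]setTI; apply: mT => //; exact: img.
have a0 : 0 < a by rewrite (lt_trans ltr01).
apply/eqP; rewrite eq_le measure_ge0 andbT leNgt; apply/negP => A0.
pose dl := fine (mu A).
have muA : mu A = dl%:E by rewrite fineK// fin_num_measure.
have dl0 : 0 < dl by rewrite -lte_fin -muA.
(* Times that are multiples of [q > 2 / mu A]: by Chebyshev, a set of measure at
   least [mu A / 2] visits A at least j times before time [q * j]. *)
pose q := Num.bound (2 / dl).
have dq : 2 < q%:R * dl.
  by rewrite -ltr_pdivrMr// archi_boundP// divr_ge0// ltW.
have [j j0] := exp_gt_poly R a (2 / dl) p q a1 (divr_ge0 (ler0n _ _) (ltW dl0)).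
rewrite ltNge => /negP; apply.
have [I [Y [cI mY covY injY]]] := cov (q * j)%N.
have := visits_chebyshev mu T A (q * j) j mT mA inv.
set E := [set x | _] => che.
have mE : measurable E by exact: measurable_visits_ge.
pose ee := fine (mu E).
have muE : mu E = ee%:E by rewrite fineK// fin_num_measure.
move: che; rewrite muA muE -!EFinM -EFinD lee_fin natrM => che.
have jR : 0 < j%:R :> R by rewrite ltr0n.
have {}che : q%:R * dl <= q%:R * ee + 1 by rewrite -(ler_pM2l jR); lra.
have q0 : 0 < q%:R :> R by rewrite -(pmulr_lgt0 _ dl0) (lt_trans _ dq).
(* Since [2 < q * dl], the error term 1 is less than half of [q * dl]. *)
have hE : dl / 2 <= ee by rewrite -(ler_pM2l q0); lra.
(* Cut [E] along the sets [Y i]: on each piece the iterate is injective, so [expansion_iter] applies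
   and the image has mass at most 1. *)
have bE : a ^+ j * ee <= (q * j).+1%:R ^+ p.
  rewrite -lee_fin EFinM -muE.
  have sE : (mu E <= \sum_(i : I) mu (E `&` Y i))%E.
    rewrite fsbig_seq ?index_enum_uniq//.
    apply: (content_sub_fsum mu) => //.
    - by move=> i _; exact: measurableI.
    - by move=> x Ex; have [i Yx] := covY x; exists i => //=; exact: mem_index_enum.
  rewrite (@le_trans _ _ ((a ^+ j)%:E * \sum_(i : I) mu (E `&` Y i))%E)//.
    by rewrite lee_pmul2l//= lte_fin exprn_gt0.
  rewrite ge0_sume_distrr//.
  rewrite (@le_trans _ _ (\sum_(i : I) 1)%E)//; last first.
    have -> : \sum_(i : I) 1%E = #|I|%:R%:E :> \bar R.
      by rewrite -[RHS]mule1 mule_natl sumr_const.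
    by rewrite -natrX lee_fin ler_nat.
  apply: lee_sum => i _.
  have mEY : measurable (E `&` Y i) by exact: measurableI.
  rewrite (@le_trans _ _ (mu (iter (q * j) T @` (E `&` Y i))))//.
    apply: (expansion_iter mu T A a) => //; first exact: ltW.
      move=> x y /set_mem[_ xY] /set_mem[_ yY]; apply: (injY i); exact: mem_set.
    by move=> x [].
  apply: probability_le1; exact: measurable_image_iter.
rewrite mulrAC ler_pdivlMr// mulrC.
have : dl / 2 * a ^+ j <= ee * a ^+ j by rewrite ler_pM2r// exprn_gt0.
lra.
Qed.
End expanding.

(** * Interval translation maps *)

Section translates.
Context {R : realType}.
Implicit Types (mu : probability (measurableTypeR R) R) (B : set R).

Lemma image_translate (c : R) B : (+%R^~ c) @` B = (fun x => x - c) @^-1` B.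
Proof.
apply/seteqP; split => [_ [x Bx <-]|x Bx]/=; first by rewrite addrK.
by exists (x - c); rewrite ?subrK.
Qed.

Lemma measurable_fun_sub (c : R) :
  measurable_fun setT (fun x : measurableTypeR R => x - c : measurableTypeR R).
Proof. exact: measurable_funB. Qed.

(** The pushforward under [x - c]: it makes the set function sending [B] to the measure of [B + c] a
    genuine measure, to which additivity and the Hahn decomposition apply. *)
Definition translate mu (c : R) : probability (measurableTypeR R) R :=
  distribution mu (mfun_Sub (mem_set (measurable_fun_sub c))).

Lemma translateE mu (c : R) B : translate mu c B = mu ((+%R^~ c) @` B).
Proof. by rewrite image_translate. Qed.

Lemma measurable_translate (c : R) (B : set (measurableTypeR R)) :
  measurable B -> measurable ((+%R^~ c) @` B : set (measurableTypeR R)).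
Proof.
move=> mB; rewrite image_translate -[X in measurable X]setTI.
exact: measurable_fun_sub.
Qed.

End translates.

Lemma measure_setI_full d (X : measurableType d) (R : realType)
    (mu : probability X R) (D B : set X) :
  measurable D -> measurable B -> mu D = 1%E -> mu (B `&` D) = mu B.
Proof.
move=> mD mB muD.
have mCD : measurable (~` D) by exact: measurableC.
have mBD : measurable (B `\` D) by exact: measurableD.
have BD0 : mu (B `\` D) = 0%E.
  apply: (subset_measure0 (mu := mu) mBD mCD); first by move=> x [].
  by apply: (etrans (probability_setC mu mD)); rewrite muD subee.
rewrite -[in RHS](setUIDK B D) measureU//; first 1 last.
- exact: measurableI.
- by apply/seteqP; split => // x [[_ ?] []].
by rewrite [X in (_ + X)%E](_ : _ = 0%E) ?adde0.
Qed.

Section itm.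
Context {R : realType} {n : nat}.
Variables (t : nat -> R) (c : 'I_n -> R) (S : R -> R).
Hypothesis hS : is_itm t c S.

Lemma itm_breakpoints_le i j : (i <= j <= n)%N -> t i <= t j.
Proof.
have [_ _ tS _] := hS; move=> /andP[+ jn].
elim: j jn => [|j IHj] jn; first by rewrite leqn0 => /eqP ->.
rewrite leq_eqVlt => /orP[/eqP -> //|]; rewrite ltnS => ij.
by rewrite (le_trans (IHj _ ij)) 1?ltnW// ltW// (tS (Ordinal jn)).
Qed.

Lemma branch_sub (k : 'I_n) : branch t k `<=` [set` `[0, 1[].
Proof.
have [t0 tn _ _] := hS; move=> x; rewrite /branch/= !in_itv/= => /andP[tx xt].
rewrite -t0 -tn; apply/andP; split.
  by rewrite (le_trans _ tx)//; apply: itm_breakpoints_le; rewrite leq0n ltnW.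
by rewrite (lt_le_trans xt)//; apply: itm_breakpoints_le; rewrite ltn_ord leqnn.
Qed.

Lemma branch_uniq (k l : 'I_n) x : branch t k x -> branch t l x -> k = l.
Proof.
wlog kl : k l / (k < l)%N.
  move=> h hk hl; have [kl|lk|/val_inj//] := ltngtP k l; first exact: h.
  by apply/esym; exact: h.
rewrite /branch/= !in_itv/= => /andP[_ xk] /andP[lx _].
have : t k.+1 <= t l by rewrite itm_breakpoints_le// kl ltnW.
by move=> /(lt_le_trans xk); rewrite ltNge lx.
Qed.

Lemma branch_cover x : [set` `[0, 1[] x -> exists k : 'I_n, branch t k x.
Proof.
have [t0 tn _ _] := hS; rewrite /= in_itv/= -t0 -tn => /andP[x0 xn].
(* The branch containing [x] ends at the least breakpoint above [x]. *)
have ex : exists j, (x < t j) && (j <= n)%N by exists n; rewrite xn leqnn.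
have [[|j] /andP[xj jn] hj] := ex_minnP ex.
  by move: xj; rewrite ltNge x0.
exists (Ordinal jn); rewrite /branch/= in_itv/= xj andbT leNgt; apply/negP => xj'.
by have := hj j; rewrite xj' ltnW// ltnn => /(_ isT).
Qed.

(* S is unconstrained outside [0,1); this total map agrees with S on [0,1) and
   is the identity elsewhere. *)
Definition itm_ext (x : R) : R := x + \sum_k c k * \1_(branch t k) x.

Lemma itm_extE k x : branch t k x -> itm_ext x = x + c k.
Proof.
move=> kx; rewrite /itm_ext (bigD1 k)//= indicE mem_set// mulr1 big1 ?addr0//.
move=> l lk; rewrite indicE memNset ?mulr0// => lx.
by move/eqP: lk; apply; exact: (branch_uniq _ _ x).
Qed.

Lemma itm_ext_out x : ~ [set` `[0, 1[] x -> itm_ext x = x.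
Proof.
move=> x01; rewrite /itm_ext big1 ?addr0// => k _.
by rewrite indicE memNset ?mulr0// => /branch_sub.
Qed.

Lemma measurable_branch (k : 'I_n) : measurable (branch t k : set (measurableTypeR R)).
Proof. exact: measurable_itv. Qed.

Lemma measurable_itm_ext :
  measurable_fun setT (itm_ext : measurableTypeR R -> measurableTypeR R).
Proof.
apply: measurable_funD => //; apply: measurable_sum => k.
apply: measurable_funM => //; apply: measurable_indic.
exact: measurable_branch.
Qed.

(** The image is a finite union of translates of Borel pieces, together with the part of [B] outside
    [[0,1)], which is fixed. *)
Lemma itm_ext_image (B : set (measurableTypeR R)) : measurable B ->
  measurable (itm_ext @` B : set (measurableTypeR R)).
Proof.
move=> mB; rewrite (_ : itm_ext @` B =
    \bigcup_(k in [set: 'I_n]) (+%R^~ (c k)) @` (B `&` branch t k) `|`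
    (B `\` [set` `[0, 1[])); last first.
  apply/seteqP; split => [_ [x Bx <-]|y].
    have [x01|x01] := pselect ([set` `[0, 1[] x).
      have [k kx] := branch_cover x x01; left; exists k => //; exists x => //.
      by rewrite (itm_extE k).
    by right; rewrite itm_ext_out.
  move=> [[k _ [x [Bx kx] <-]]|[By y01]].
    by exists x => //; rewrite (itm_extE k).
  by exists y => //; rewrite itm_ext_out.
apply: measurableU; last exact: measurableD.
apply: fin_bigcup_measurable => [|k _]; first exact: finite_finset.
by apply: measurable_translate; apply: measurableI => //; exact: measurable_branch.
Qed.

(** Translations commute, so the total displacement depends on how often each branch is visited, not
    on the order. *)
Lemma itm_ext_visits m x : iter m itm_ext x =
  x + \sum_k c k * (visits itm_ext (branch t k) m x)%:R.
Proof.
elim: m x => [|m IHm] x.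
  by rewrite /= big1 ?addr0// => k _; rewrite /visits big_ord0 mulr0.
rewrite iterSr IHm {1}/itm_ext -addrA -big_split/=; congr (_ + _).
by apply: eq_bigr => k _; rewrite visitsS natrD mulrDr indicE.
Qed.

(* On the set of points with prescribed numbers of visits to the branches, the
   m-th iterate is a single translation; there are only polynomially many such
   sets. *)
Lemma itm_ext_cover m : exists (I : finType) (Y : I -> set (measurableTypeR R)),
  [/\ (#|I| <= m.+1 ^ n)%N, forall i, measurable (Y i),
      forall x, exists i, Y i x & forall i, set_inj (Y i) (iter m itm_ext)].
Proof.
pose s (v : {ffun 'I_n -> 'I_m.+1}) := \sum_k c k * (v k)%:R.
exists {ffun 'I_n -> 'I_m.+1}, (fun v => [set x | iter m itm_ext x = x + s v]).
split=> [|v|x|v x y]; first by rewrite card_ffun !card_ord.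
(* Each piece is a level set of the displacement, a measurable function. *)
- have mf : measurable_fun setT (fun x : measurableTypeR R =>
      iter m itm_ext x - x : measurableTypeR R).
    apply: measurable_funB => //; apply: measurable_iter.
    exact: measurable_itm_ext.
  have := mf measurableT [set s v] (measurable_set1 _).
  rewrite setTI; congr measurable; apply/seteqP; split => x /=.
    by move=> <-; rewrite addrC subrK.
  by move=> ->; rewrite addrAC subrr add0r.
- exists [ffun k => inord (visits itm_ext (branch t k) m x)] => /=.
  rewrite itm_ext_visits; congr (_ + _); apply: eq_bigr => k _.
  by rewrite ffunE inordK// ltnS visits_le.
- by move=> /set_mem /= -> /set_mem /= -> /addIr.
Qed.

(** * Invariant measures of interval translation maps *)

Variable mu : probability (measurableTypeR R) R.
Hypothesis mu01 : mu [set` `[0, 1[] = 1%E.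
Hypothesis mu_inv : itm_invariant S mu.

(** As [[0,1)] has full mass, both sides may be restricted to it, and there [itm_ext] agrees with
    [S]. *)
Lemma itm_ext_invariant (B : set (measurableTypeR R)) : measurable B ->
  mu (itm_ext @^-1` B) = mu B.
Proof.
move=> mB; have [_ _ _ Sk] := hS.
have m01 : measurable ([set` `[0, 1[] : set (measurableTypeR R)).
  exact: measurable_itv.
rewrite -(measure_setI_full _ _ _ mu _ B m01 mB mu01).
rewrite -[RHS]mu_inv; [|exact: measurableI|exact: subIsetr].
rewrite -[in LHS](measure_setI_full _ _ _ mu _ _ m01 _ mu01); last first.
  by rewrite -[X in measurable X]setTI; exact: measurable_itm_ext.
congr (mu _); apply/seteqP; split => x.
  move=> [/= Bx x01]; split => //; have [k kx] := branch_cover x x01.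
  by have [-> T01] := Sk _ _ kx; move: Bx; rewrite (itm_extE k).
move=> [x01 /= [BSx _]]; split => //=; have [k kx] := branch_cover x x01.
by move: BSx; have [-> _] := Sk _ _ kx; rewrite (itm_extE k).
Qed.

(** Positivity of the defect: [B] lies in the preimage of its own image, whose measure is that of
    the image by invariance. *)
Lemma measure_tau_ge k (B : set (measurableTypeR R)) : measurable B ->
  B `<=` branch t k -> (mu B <= mu (tau c k @` B))%E.
Proof.
move=> mB Bk.
have mtB : measurable (tau c k @` B : set (measurableTypeR R)).
  exact: measurable_translate.
rewrite -[leRHS](itm_ext_invariant _ mtB); apply: le_measure; rewrite ?inE//.
  by rewrite -[X in measurable X]setTI; exact: measurable_itm_ext.
by move=> x Bx; exists x => //; rewrite (itm_extE k)//; exact: Bk.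
Qed.

Lemma itm_expanding_null k (A : set (measurableTypeR R)) (a : R) :
    measurable A -> A `<=` branch t k -> 1 < a ->
    (forall B : set (measurableTypeR R), measurable B -> B `<=` A ->
      (a%:E * mu B <= mu (tau c k @` B))%E) ->
  mu A = 0%E.
Proof.
move=> mA Ak a1 exp.
apply: (expanding_null mu itm_ext A a n measurable_itm_ext
  itm_ext_invariant itm_ext_image itm_ext_cover mA a1) => B mB BA.
rewrite (_ : itm_ext @` B = tau c k @` B); first exact: exp.
by apply: eq_imagel => x Bx; rewrite (itm_extE k)//; apply: Ak; exact: BA.
Qed.

(* By nonsingularity the excess of [mu \o tau] over [mu] has a density on the
   support; a Hahn decomposition of [mu \o tau - a mu] isolates the part where
   that density is at least [a - 1 > 0], which is a null set. *)
Lemma measure_tau_supp k (B : set (measurableTypeR R)) :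
    nonsingular_on_supp t c mu ->
    measurable (supp mu : set (measurableTypeR R)) ->
    measurable B -> B `<=` supp mu `&` branch t k ->
  mu (tau c k @` B) = mu B.
Proof.
move=> ns mJ mB BJ; apply/eqP; rewrite eq_le; apply/andP; split; last first.
  by apply: measure_tau_ge => // x /BJ[].
have tE C : mu (tau c k @` C) = translate mu (c k) C by rewrite translateE.
(* Let [a] decrease to 1: for [a = 1 + e] the excess is at most [e], because [mu B <= 1]. *)
suff le_a (a : R) : 1 < a -> (mu (tau c k @` B) <= a%:E * mu B)%E.
  have fB : mu B \is a fin_num by exact: fin_num_measure.
  apply/lee_addgt0Pr => e e0.
  rewrite (le_trans (le_a (1 + e) _)) ?ltrDl// EFinD.
  rewrite ge0_muleDl ?lee_fin//; last exact: ltW.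
  rewrite mul1e leeD2l// -[leRHS]mule1 lee_pmul2l//; exact: probability_le1.
move=> a1; pose nu := cadd (charge_of_finite_measure (translate mu (c k)))
  (cscale (- a) (charge_of_finite_measure mu)).
have nuE (C : set (measurableTypeR R)) : measurable C ->
    nu C = (mu (tau c k @` C) - a%:E * mu C)%E.
  by move=> mC; rewrite tE /nu /cadd/= /cscale EFinN mulNe.
have [P [N [[mP posP] [mN negN] PN _]]] := Hahn_decomposition nu.
have fin (C : set (measurableTypeR R)) : measurable C ->
    (a%:E * mu C)%E \is a fin_num.
  by move=> mC; rewrite fin_numM// fin_num_measure.
have mk := measurable_branch k.
(* Positivity of [nu] on subsets of [P] says exactly that they are expanded by the factor [a]. *)
have P0 : mu (P `&` (supp mu `&` branch t k)) = 0%E.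
  apply: (itm_expanding_null k _ a) => //.
  - by apply: measurableI => //; exact: measurableI.
  - by move=> x [_ []].
  - move=> C mC CP; rewrite -sube_ge0 ?fin// -nuE//.
    by apply: posP => // x /CP[].
(* Nonsingularity turns the null set [P]&[B] into one with null image, so only the part in [N]
   contributes. *)
have PB0 : translate mu (c k) (P `&` B) = 0%E.
  rewrite -tE; apply: ns; [exact: measurableI|by move=> x [_ /BJ]|].
  apply: (subset_measure0 (mu := mu) _ _ _ P0).
  - exact: measurableI.
  - by apply: measurableI => //; exact: measurableI.
  - by move=> x [Px /BJ].
have NB : (translate mu (c k) (N `&` B) <= a%:E * mu (N `&` B))%E.
  have mNB : measurable (N `&` B) by exact: measurableI.
  rewrite -tE -sube_le0 -nuE//; apply: negN => // x [].
have BE : B = (P `&` B) `|` (N `&` B) by rewrite -setIUl PN setTI.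
rewrite tE [in leLHS]BE (le_trans (measureU2 _ _ _))//; [exact: measurableI|exact: measurableI|].
rewrite [X in (X + _)%E](_ : _ = 0%E)// add0e (le_trans NB)//.
rewrite lee_pmul2l//= ?lte_fin ?(lt_trans ltr01)//.
by apply: le_measure; rewrite ?inE//; exact: measurableI.
Qed.

End itm.

(** * Supports, distribution functions and gaps *)

Section support.
Context {R : realType}.

(** A Lindelöf argument: the null intervals with rational endpoints, enumerated by [F], form a
    countable cover of [W]. *)
Lemma null_of_locally_null (mu : {measure set (measurableTypeR R) -> \bar R})
    (W : set (measurableTypeR R)) :
    measurable W ->
    (forall x, W x -> exists U : set R, [/\ open U, U x & mu U = 0%E]) ->
  mu W = 0%E.
Proof.
move=> mW Wloc; pose J (q : rat * rat) : set (measurableTypeR R) :=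
  [set` `]ratr q.1, ratr q.2[].
pose F (i : nat) : set (measurableTypeR R) :=
  if unpickle i is Some q then
    if mu (J q) == 0%E then J q else set0 else set0.
have mF i : measurable (F i).
  by rewrite /F; case: unpickle => // q; case: ifP => // _; exact: measurable_itv.
have F0 i : mu.-negligible (F i).
  apply/negligibleP => //.
  rewrite /F; case: unpickle => [q|]; last exact: measure0.
  by case: ifPn => [/eqP//|_]; exact: measure0.
apply: measure_negligible => //.
apply: (negligibleS _ (negligible_bigcup F0)) => x Wx.
have [U [oU Ux U0]] := Wloc _ Wx.
have /nbhs_ballP[e /= e0 eU] : nbhs (x : R) U by exact: open_nbhs_nbhs.
have xe : x - e < x by rewrite ltrBlDr ltrDl.
have ex : x < x + e by rewrite ltrDl.
have [p] := rat_in_itvoo xe; rewrite in_itv/= => /andP[p1 p2].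
have [q] := rat_in_itvoo ex; rewrite in_itv/= => /andP[q1 q2].
exists (pickle (p, q)); first exact: I.
rewrite /F pickleK ifT.
  by rewrite /J/= in_itv/= p2 q1.
have mU : measurable (U : set (measurableTypeR R)) by exact: open_measurable.
apply/eqP; apply: (subset_measure0 (mu := mu) (measurable_itv _) mU _ U0).
move=> y; rewrite /J/= in_itv/= => /andP[py yq]; apply: eU.
by rewrite /ball/= ltr_distlC; apply/andP; split; lra.
Qed.

(** Stated for arbitrary set functions so that it applies to [rho], which is not packaged as a
    measure. *)
Lemma closed_supp (f : set R -> \bar R) : closed (supp f).
Proof.
rewrite -[supp f]setCK; apply: open_closedC.
rewrite openE => x /existsNP[U /not_implyP[oU /not_implyP[Ux U0]]].
apply: (filterS _ (open_nbhs_nbhs (conj oU Ux))) => y Uy /(_ U oU Uy).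
exact: U0.
Qed.

Lemma measurable_supp (f : set R -> \bar R) :
  measurable (supp f : set (measurableTypeR R)).
Proof. by apply: closed_measurable; exact: closed_supp. Qed.

Lemma measure_suppC (mu : {measure set (measurableTypeR R) -> \bar R}) :
  mu (~` supp mu) = 0%E.
Proof.
apply: null_of_locally_null; first by apply: measurableC; exact: measurable_supp.
move=> x /existsNP[U /not_implyP[oU /not_implyP[Ux U0]]].
exists U; split => //; apply/eqP; rewrite eq_le measure_ge0 andbT leNgt.
exact/negP.
Qed.

Variable mu : probability (measurableTypeR R) R.

Lemma distr_fun_le x y : x <= y -> distr_fun mu x <= distr_fun mu y.
Proof.
move=> xy; rewrite /distr_fun fine_le//.
- by apply: fin_num_measure; exact: measurable_itv.
- by apply: fin_num_measure; exact: measurable_itv.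
- apply: le_measure; rewrite ?inE; try exact: measurable_itv.
  by apply: subset_itvl; rewrite bnd_simp.
Qed.

Lemma measurable_distr_fun (U : set (measurableTypeR R)) :
  measurable U -> measurable (distr_fun mu @^-1` U : set (measurableTypeR R)).
Proof.
move=> mU; rewrite -[X in measurable X]setTI.
by apply: nondecreasing_measurable => //= x y; exact: distr_fun_le.
Qed.

Lemma distr_fun_null a x : 0 <= a -> a <= x ->
  mu [set` `]a, x]] = 0%E -> distr_fun mu x = distr_fun mu a.
Proof.
move=> a0 ax ax0; rewrite /distr_fun; congr fine.
have -> : [set` `[0, x]] = [set` `[0, a]] `|` [set` `]a, x]].
  by rewrite -itv_bndbnd_setU// bnd_simp.
rewrite measureU; [|exact: measurable_itv|exact: measurable_itv|].
  by rewrite [X in (_ + X)%E](_ : _ = 0%E) ?adde0.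
apply/seteqP; split => // y [] /=; rewrite !in_itv/= => /andP[_ ya] /andP[ay _].
by move: ay; rewrite ltNge ya.
Qed.

End support.

(** The component is a bounded interval, and it is open because balls are connected; hence it equals
    its interior, the open interval between its infimum and supremum. *)
Lemma component_open_bounded (R : realType) (D : set R) (l r x : R) :
    open D -> D `<=` [set` `]l, r[] -> D x ->
  exists a b, connected_component D x = [set` `]a, b[].
Proof.
move=> oD Dlr Dx; set C := connected_component D x.
have Cx : C x by exact: connected_component_refl.
have CD : C `<=` D by exact: connected_component_sub.
have iC : is_interval C.
  exact/connected_intervalP/component_connected.
have lC : has_lbound C.
  by exists l => y /CD/Dlr /=; rewrite in_itv/= => /andP[/ltW].
have uC : has_ubound C.
  by exists r => y /CD/Dlr /=; rewrite in_itv/= => /andP[_ /ltW].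
have oC : open C.
  rewrite openE => y Cy.
  have /nbhs_ballP[e /= e0 eD] : nbhs y D by exact/open_nbhs_nbhs/(conj oD)/CD.
  apply/nbhs_ballP; exists e => //=.
  suff -> : C = connected_component D y.
    apply: connected_component_max => //; first exact: ballxx.
    apply/connected_intervalP => u v; rewrite /ball/= !ltr_distlC.
    move=> /andP[u1 u2] /andP[v1 v2] z /andP[uz zv].
    by rewrite ltr_distlC; apply/andP; split; lra.
  apply/seteqP; split => z.
    by apply: connected_component_trans; exact: connected_component_sym.
  exact: connected_component_trans.
exists (inf C), (sup C); rewrite -[LHS]((interior_id C).1 oC).
by rewrite interval_bounded_interior.
Qed.

(** * The support of the defect transported by the distribution function *)

Theorem proposition7p6 (R : realType) (n : nat) (t : nat -> R) (c : 'I_n -> R)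
    (S : R -> R) (mu : probability (measurableTypeR R) R)
    (hS : is_itm t c S)
    (mu01 : mu [set` `[0, 1[] = 1%E)
    (mu_inv : itm_invariant S mu)
    (mu_na : non_atomic mu)
    (mu_ns : nonsingular_on_supp t c mu) (k : 'I_n) :
  supp (rho t c mu k) = closure (gap_values t c mu k).
Proof.
pose h := distr_fun mu; pose J := supp mu; pose nu := translate mu (c k).
have mJ : measurable (J : set (measurableTypeR R)) by exact: measurable_supp.
have mk : measurable (branch t k : set (measurableTypeR R)) by exact: measurable_branch.
have nuE B : mu (tau c k @` B) = nu B by rewrite /nu translateE.
have J0 : mu (~` J) = 0%E := measure_suppC mu.
have mCJ : measurable (~` J : set (measurableTypeR R)) by exact: measurableC.
pose D := [set` `]t k, t k.+1[] `\` J.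
have mD : measurable (D : set (measurableTypeR R)).
  by apply: measurableD => //; exact: measurable_itv.
have oD : open D.
  apply: openI; first exact: interval_open.
  exact/closed_openC/closed_supp.
have tk0 : 0 <= t k.
  have : [set` `[0, 1[] (t k).
    apply: (branch_sub _ _ _ hS k); have [_ _ tS _] := hS.
    by rewrite /branch/= in_itv/= lexx tS.
  by rewrite /= in_itv/= => /andP[].
pose X (U : set R) := h @^-1` U `&` branch t k.
have mX U : open U -> measurable (X U : set (measurableTypeR R)).
  move=> oU; apply: measurableI => //; apply: measurable_distr_fun.
  exact: open_measurable.
have gap a b : is_branch_gap t mu k a b ->
    [/\ [set` `]a, b[] `<=` D, 0 <= a &
        forall x, [set` `]a, b[] x -> h x = h a].
  move=> [x Dx Cab]; have abD : [set` `]a, b[] `<=` D.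
    by rewrite -Cab; exact: connected_component_sub.
  have : [set` `]a, b[] x by rewrite -Cab; exact: connected_component_refl.
  rewrite /= in_itv/= => /andP[ax xb].
  have a0 : 0 <= a.
    (* If [a < t k], the gap would contain the minimum of [x] and [t k], which is not inside the
       open branch. *)
    rewrite (le_trans tk0)// leNgt; apply/negP => atk.
    have [+ _] : D (Num.min x (t k)).
      by apply: abD; rewrite /= in_itv/= lt_min ax atk/= gt_min xb.
    by rewrite /= in_itv/= lt_min ltxx andbF.
  split => // y; rewrite /= in_itv/= => /andP[ay yb].
  apply: distr_fun_null => //; first exact: ltW.
  apply: (subset_measure0 (mu := mu) (measurable_itv _) mCJ) => // z.
  rewrite /= in_itv/= => /andP[az zy].
  have [] // : D z by apply: abD; rewrite /= in_itv/= az (le_lt_trans zy).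
apply/seteqP; split => y; last first.
  (* The support is closed, so it is enough that it contains the value of each active gap. *)
  have /closure_id -> := closed_supp (rho t c mu k).
  apply: closure_subset => {y} _ [a [b [abgap act ->]]] U oU Ua.
  have [abD a0 ha] := gap a b abgap.
  set G := [set` `]a, b[] in act abD ha.
  have mG : measurable (G : set (measurableTypeR R)) by exact: measurable_itv.
  have GX : G `<=` X U.
    move=> x Gx; split; first by rewrite /preimage/= ha.
    by have [] := abD _ Gx; rewrite /branch/= !in_itv/= => /andP[/ltW -> ->].
  have G0 : mu G = 0%E.
    by apply: (subset_measure0 (mu := mu) mG mCJ _ J0) => x /abD[].
  have mXG : measurable (X U `\` G : set (measurableTypeR R)).
    by apply: measurableD => //; exact: mX.
  have XUE : X U = (X U `\` G) `|` G by rewrite setUC setDUK.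
  have dXG : (X U `\` G) `&` G = set0 by apply/seteqP; split => // x [[]].
  have XGle : (mu (X U `\` G) <= nu (X U `\` G))%E.
    by rewrite -nuE; apply: (measure_tau_ge _ _ _ hS _ mu01 mu_inv) => // x [[]].
  have G_gt0 : (0 < nu G)%E by rewrite -nuE.
  (* The defect is nonnegative on [X U] minus [G], and on [G] it equals [nu G > 0]. *)
  rewrite /rho /defect -/(X U) sube_gt0 nuE XUE !measureU//.
  rewrite [X in (_ + X < _)%E](_ : _ = 0%E)// adde0.
  apply: (le_lt_trans XGle).
  by rewrite lteDl ?fin_num_measure.
move=> suppy V Vy.
have [U [oU Uy UV]] : exists U, [/\ open U, U y & U `<=` V].
  by move: Vy; rewrite nbhsE => -[U [oU Uy] UV]; exists U.
have /= := suppy U oU Uy.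
rewrite /rho /defect -/(X U) sube_gt0 nuE => rhoU.
(* If [V] contains no active value, then [X U] has no defect: its parts in the gaps, in the support
   and at [t k] are treated separately. *)
apply: contrapT => noV; move: rhoU; apply/negP; rewrite -leNgt.
(* A gap meeting [X U] has its value in [U], so it is inactive and serves as a [nu]-null
   neighbourhood of its points. *)
have nuD : nu (X U `&` D) = 0%E.
  apply: null_of_locally_null; first by apply: measurableI => //; exact: mX.
  move=> x [[Ux _] Dx].
  have [a [b Cab]] : exists a b, connected_component D x = [set` `]a, b[].
    by apply: (component_open_bounded _ _ (t k) (t k.+1)) => // z [].
  have abgap : is_branch_gap t mu k a b by exists x.
  have [abD a0 ha] := gap a b abgap.
  have xab : [set` `]a, b[] x by rewrite -Cab; exact: connected_component_refl.
  exists [set` `]a, b[]; split => //.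
  apply/eqP; rewrite eq_le measure_ge0 andbT leNgt; apply/negP => act.
  apply: noV; exists (h a); split; last by apply: UV; rewrite -(ha x).
  by exists a, b; split => //; rewrite /is_active nuE.
have nuJ : nu (X U `&` J) = mu (X U `&` J).
  rewrite -nuE; apply: (measure_tau_supp _ _ _ hS _ mu01 mu_inv) => //.
    by apply: measurableI => //; exact: mX.
  by move=> x [[_ ?] ?].
(* The endpoint [t k] belongs to the branch but to no gap; its image is a point, null since [mu] has
   no atoms. *)
have nut : nu [set t k] = 0%E by rewrite -nuE image_set1.
have mXJ : measurable (X U `&` J : set (measurableTypeR R)).
  by apply: measurableI => //; exact: mX.
have mXD : measurable (X U `&` D : set (measurableTypeR R)).
  by apply: measurableI => //; exact: mX.
have mtk : measurable ([set t k] : set (measurableTypeR R)) by exact: measurable_set1.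
have XS : X U `<=` (X U `&` J) `|` ((X U `&` D) `|` [set t k]).
  move=> x Xx; have [Jx|Jx] := pselect (J x); [by left|right].
  have [_] := Xx; rewrite /branch/= in_itv/= => /andP[tx xt].
  have [->|xt'] := eqVneq x (t k); [by right|left].
  by split => //; split => //; rewrite /= in_itv/= xt andbT lt_neqAle eq_sym xt'.
apply: (@le_trans _ _ (nu ((X U `&` J) `|` ((X U `&` D) `|` [set t k])))).
  apply: le_measure => //; rewrite inE; first exact: mX.
  by apply: measurableU => //; exact: measurableU.
apply: (le_trans (measureU2 _ _ _)) => //; first exact: measurableU.
rewrite [X in (_ + X)%E](_ : _ = 0%E); last first.
  apply/eqP; rewrite eq_le measure_ge0 andbT.
  apply: (le_trans (measureU2 _ _ _)) => //.
  by rewrite [X in (X + _)%E](_ : _ = 0%E)// add0e le_eqVlt; apply/orP; left; apply/eqP.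
rewrite adde0 [leLHS](_ : _ = mu (X U `&` J))//.
by apply: le_measure; rewrite ?inE//; exact: mX.
Qed.
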